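(* Let $H$ be a finite-dimensional complex Hilbert space and let $k$ be a positive integer such that $\dim H>2k$. Write $\dim H=mk+i$ with integers $m\ge 2$ and $i\in\{0,1,\dots,k-1\}$ (so that $m\ge 3$ if $i=0$). Suppose that one of the following conditions is satisfied: (a) $i\in\{0,1,2,3\}$; (b) $i\ge 4$ and $m\ge i+1$. Let $f:{\mathcal G}_{k}(H)\to{\mathcal G}_{k}(H)$ be an injective map preserving the orthogonality relation, i.e. for any orthogonal $X,Y\in{\mathcal G}_{k}(H)$ the images $f(X),f(Y)$ are orthogonal. Then $f$ is a bijection induced by a unitary or anti-unitary operator on $H$, i.e. $f$ is bijective and there is a unitary or anti-unitary operator $U:H\to H$ such that $f(X)=U(X)$ for every $X\in{\mathcal G}_{k}(H)$.
   Context: ${\mathcal G}_{k}(H)$ denotes the set of all $k$-dimensional (complex linear) subspaces of $H$. Two subspaces $X,Y$ are orthogonal if every vector of $X$ is orthogonal to every vector of $Y$. An anti-unitary operator is a conjugate-linear bijection $U:H\to H$ with $\langle Ux,Uy\rangle=\overline{\langle x,y\rangle}$ for all $x,y\in H$. *)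

(* Defs.v *)
From mathcomp Require Import all_boot all_order all_algebra.
From mathcomp Require Import reals.
From mathcomp Require Import complex.

Set Implicit Arguments.
Unset Strict Implicit.
Unset Printing Implicit Defensive.

Import GRing.Theory Num.Theory.
Local Open Scope ring_scope.

(* A finite-dimensional complex Hilbert space is a vectType H over R[i], with
   R : realType, together with a positive definite Hermitian form
   dot : {dot H for Num.conj}, linear in its first argument.  A realType is
   needed rather than an arbitrary numClosedFieldType: the scalars must be the
   complex numbers, whose only automorphisms commuting with the conjugation are
   the identity and the conjugation itself. *)

Definition grassmannian (R : realType) (H : vectType R[i]) (k : nat) :=
  {X : {vspace H} | \dim X == k}.

Section HilbertSpace.
Variables (R : realType) (H : vectType R[i]) (dot : {dot H for Num.conj}).

Definition orthogonal_subspaces (X Y : {vspace H}) : Prop :=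
  {in X & Y, forall x y, dot x y = 0}.

Definition unitary (U : H -> H) : Prop :=
  [/\ linear U, bijective U & forall x y, dot (U x) (U y) = dot x y].

Definition antiunitary (U : H -> H) : Prop :=
  [/\ linear_for (Num.conj \; *:%R) U,
      bijective U
    & forall x y, dot (U x) (U y) = Num.conj (dot x y)].

(* An anti-unitary operator is not linear over R[i], so its images of subspaces
   are described elementwise instead of by the library's (_ @: _)%VS. *)
Definition is_image (U : H -> H) (X Y : {vspace H}) : Prop :=
  forall y, y \in Y <-> exists2 x, x \in X & y = U x.

End HilbertSpace.

(* Main.v *)
From HB Require Import structures.
Require Import Defs.
From mathcomp Require Import all_boot all_order all_algebra.
From mathcomp Require Import reals.
From mathcomp Require Import complex.
From mathcomp Require Import boolp zify ring.

Set Implicit Arguments.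
Unset Strict Implicit.
Unset Printing Implicit Defensive.

Import Order.TTheory GRing.Theory Num.Theory.
Local Open Scope ring_scope.

(* Let n = dim H, and let e_0, ..., e_{n-1} be an orthogonal basis, indexed
   cyclically.  For the k-dimensional spans X_j of k consecutive e's, put
   l(j, r) = dim (f(X_j) + ... + f(X_{j+r})).  By modularity the sum u(r) of the
   l(j, r) over j is concave in r; moreover u(0) = nk, u((q-1)k) >= nqk when
   qk <= n (orthogonal blocks), and u(r) + u(n-2k-r) <= n^2 (orthogonal arcs).
   As n > 2k, this forces u(r) = n(k+r) for r <= n-2k, and with injectivity
   l(j, r) = k+r.  Hence the images of the k-subspaces of Z lie in a subspace of
   dimension dim Z when k <= dim Z <= n-k; the case dim Z = k+1 propagates this
   to all Z.  For a hyperplane Z, the orthogonal complement of a vector v, this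
   yields a nonzero vector h(v), orthogonal to all f(X) with X orthogonal to v.
   One checks that h maps X into f(X), preserves orthogonality and is injective
   on lines, so that the case k = 1 (Wigner's theorem for maps preserving
   orthogonality in one direction) describes h, and thus f. *)

(** * Concave sequences of natural numbers *)

(** Increments do not grow. If the one at [r] is at least [s], so are all earlier ones, and summing
    from 0 gives the bound; otherwise all later ones are below [s], and the bound follows backwards
    from [M]. *)
Lemma concave_above_chord (u : nat -> nat) (s M : nat) :
    (forall r, (u r.+2 + u r <= u r.+1 + u r.+1)%N) ->
    (u 0 + s * M <= u M)%N ->
  forall r, (r <= M)%N -> (u 0 + s * r <= u r)%N.
Proof.
move=> concave uM r le_rM.
have slope t d : (u (t + d).+1 + u t <= u t.+1 + u (t + d))%N.
  elim: d => [|d IHd]; first by rewrite addn0; lia.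
  by move: (concave (t + d)%N); rewrite addnS; lia.
have [le_s|gt_s] := leqP (u r + s) (u r.+1).
  suff up t : (t <= r)%N -> (u 0 + s * t <= u t)%N by exact: up.
  elim: t => [|t IHt] lt_tr; first by lia.
  move: (IHt (ltnW lt_tr)) (slope t (r - t)%N).
  by rewrite (subnKC (ltnW lt_tr)); lia.
have down d : (u (r + d) <= u r + s * d)%N.
  elim: d => [|d IHd]; first by rewrite addn0; lia.
  by move: (slope r d); rewrite addnS; lia.
move: (down (M - r)%N); rewrite (subnKC le_rM); move: uM.
by rewrite -{1}(subnKC le_rM) mulnDr; lia.
Qed.

(** * Subspaces of prescribed dimension *)

Section SubspaceOfDim.
Variables (K : fieldType) (V : vectType K).
Implicit Types (A B : {vspace V}) (v : V).

Lemma dim_add_line A v : (\dim (A + <[v]>) <= (\dim A).+1)%N.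
Proof.
by apply: leq_trans (dimv_add_leqif _ _) _; rewrite dim_vline; case: eqP; lia.
Qed.

Lemma dim_add_line_notin A v : v \notin A -> \dim (A + <[v]>) = (\dim A).+1.
Proof.
move=> vA; apply/eqP; rewrite eqn_leq dim_add_line /=.
rewrite ltnNge; apply: contra vA => le_dim.
have /eqP-> : A == (A + <[v]>)%VS by rewrite eqEdim addvSl.
by rewrite memvE addvSr.
Qed.

(** Vectors of [B] outside the current subspace are adjoined one at a time. *)
Lemma vspace_of_dim A B d : (A <= B)%VS -> (\dim A <= d <= \dim B)%N ->
  exists W, [/\ (A <= W)%VS, (W <= B)%VS & \dim W = d].
Proof.
move=> sAB /andP[]; have [r] := ubnP (d - \dim A)%N.
elim: r A sAB => // r IHr A sAB lt_r le_Ad le_dB.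
have [eq_d|lt_d] := eqVneq (\dim A) d; first by exists A; rewrite subvv.
have /subvPn[v vB vA] : ~~ (B <= A)%VS.
  by apply/negP => /dimvS; move: lt_d; lia.
have [||||W [sAW sWB dW]] := IHr (A + <[v]>)%VS.
- by rewrite subv_add sAB -memvE.
- by rewrite dim_add_line_notin //; lia.
- by rewrite dim_add_line_notin //; lia.
- by [].
by exists W; split=> //; exact: subv_trans (addvSl _ _) sAW.
Qed.

Lemma not_subv_union A B1 B2 : ~~ (A <= B1)%VS -> ~~ (A <= B2)%VS ->
  exists v, [/\ v \in A, v \notin B1 & v \notin B2].
Proof.
move=> /subvPn[x xA xB1] /subvPn[y yA yB2].
have [xB2|] := boolP (x \in B2); last by exists x.
have [yB1|] := boolP (y \in B1); last by exists y.
exists (x + y); rewrite rpredD //; split=> //.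
  by rewrite rpredDr.
by rewrite rpredDl.
Qed.

End SubspaceOfDim.

(** * Orthogonal complements and orthogonal bases *)

Section Orthogonality.
Variables (C : numClosedFieldType) (H : vectType C).
Variable dot : {dot H for Num.conj}.
Implicit Types (A B U V W : {vspace H}) (u v w : H).

Local Notation "A ^⊥" := (orthov dot A) (at level 2, format "A ^⊥").

Lemma dot_eq0C u v : (dot u v == 0) = (dot v u == 0).
Proof. exact: herm_eq0C. Qed.

Lemma dotDl u v w : dot (u + v) w = dot u w + dot v w.
Proof. exact: linearDl. Qed.

Lemma dotDr u v w : dot u (v + w) = dot u v + dot u w.
Proof. exact: linearDr. Qed.

Lemma dotZl (c : C) u v : dot (c *: u) v = c * dot u v.
Proof. exact: linearZl_LR. Qed.

Lemma dotZr (c : C) u v : dot u (c *: v) = Num.conj c * dot u v.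
Proof. exact: linearZr_LR. Qed.

Lemma dot0l u : dot 0 u = 0. Proof. exact: linear0l. Qed.

Lemma dot_suml (I : Type) (r : seq I) (P : pred I) (E : I -> H) u :
  dot (\sum_(i <- r | P i) E i) u = \sum_(i <- r | P i) dot (E i) u.
Proof. exact: linear_sumlz. Qed.

Lemma dot_sumr (I : Type) (r : seq I) (P : pred I) (E : I -> H) u :
  dot u (\sum_(i <- r | P i) E i) = \sum_(i <- r | P i) dot u (E i).
Proof. exact: linear_sumr. Qed.

Lemma in_orthP A u : reflect {in A, forall v, dot u v = 0} (u \in A^⊥).
Proof. exact: mem_orthovP. Qed.

Lemma orth_lines u v : (<[u]> <= <[v]>^⊥)%VS = (dot u v == 0).
Proof. exact: orthov11. Qed.

Lemma orthovS A B : (A <= B)%VS -> (B^⊥ <= A^⊥)%VS.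
Proof.
move=> /subvP sAB; apply/subvP=> x /mem_orthovP xB.
by apply/mem_orthovP=> y /sAB; exact: xB.
Qed.

Lemma capv_orthov A : (A :&: A^⊥ = 0)%VS.
Proof.
apply/eqP; rewrite -subv0; apply/subvP=> v; rewrite memv_cap => /andP[vA].
by move=> /mem_orthovP/(_ _ vA)/eqP; rewrite dnorm_eq0 memv0.
Qed.

Lemma addv_orthov A : (A + A^⊥ = fullv)%VS.
Proof.
apply/eqP; rewrite eqEsubv subvf; apply/subvP=> v _.
have [x xA [y [-> _ /(orthoPl (form := dot)) yA]]] :=
  orthogonal_split dot (vbasis A) v.
rewrite (span_basis (vbasisP A)) in xA.
apply: memv_add => //; apply/mem_orthovP=> z zA.
rewrite (coord_vbasis zA) linear_sumr big1 // => i _ /=.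
by rewrite linearZr_LR /= yA ?mulr0 ?mem_nth ?size_tuple.
Qed.

Lemma dim_orthov A : \dim A^⊥ = (\dim {:H} - \dim A)%N.
Proof. by rewrite -(addv_orthov A) dimv_disjoint_sum ?capv_orthov ?addKn. Qed.

Lemma orthovK A : (A^⊥)^⊥ = A.
Proof.
apply/eqP; rewrite eq_sym eqEdim orthov_sym subvv !dim_orthov.
by have := dimvS (subvf A); lia.
Qed.

Lemma dim_addv_orth A B : (A <= B^⊥)%VS -> \dim (A + B) = (\dim A + \dim B)%N.
Proof.
move=> AB; rewrite dimv_disjoint_sum //; apply/eqP; rewrite -subv0.
by rewrite -(capv_orthov B) subv_cap capvSr (subv_trans (capvSl _ _)).
Qed.

Lemma dim_capv_orthov1 A v : v \in A -> v != 0 ->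
  (\dim (A :&: <[v]>^⊥)).+1 = \dim A.
Proof.
move=> vA v0; have /= := @dimv_sum_cap _ _ <[v]>%VS (A :&: <[v]>^⊥)%VS.
have -> : (<[v]> :&: (A :&: <[v]>^⊥) = 0)%VS.
  apply/eqP; rewrite -subv0 -(capv_orthov <[v]>) subv_cap capvSl.
  by rewrite (subv_trans (capvSr _ _)) ?capvSr.
have -> : (<[v]> + (A :&: <[v]>^⊥))%VS = A.
  rewrite capvC vspace_modl -?memvE // addv_orthov.
  by rewrite capfv.
by rewrite dimv0 addn0 dim_vline v0 add1n.
Qed.

Lemma dim_sum_orth (V : nat -> {vspace H}) r :
    (forall t t', (t < t' < r)%N -> (V t' <= (V t)^⊥)%VS) ->
  \dim (\sum_(t < r) V t) = (\sum_(t < r) \dim (V t))%N.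
Proof.
elim: r => [|r IHr] oV; first by rewrite !big_ord0 dimv0.
rewrite !big_ord_recr /= addvC dim_addv_orth; last first.
  rewrite orthov_sym; apply/subv_sumP=> t _.
  by rewrite orthov_sym oV // ltn_ord /=.
by rewrite IHr ?(addnC (\sum_(_ < _) _)%N) // => t t' ?; apply: oV; lia.
Qed.

(** Induction on the dimension: a nonzero vector of [A] is followed by a basis of its complement
    within [A]. *)
Lemma orthogonal_basis A :
  exists2 s, pairwise_orthogonal dot s & (<<s>> = A)%VS.
Proof.
have [r] := ubnP (\dim A); elim: r A => // r IHr A lt_r.
have [->|A0] := eqVneq A 0%VS; first by exists [::]; rewrite ?span_nil.
have v0 : vpick A != 0 by rewrite vpick0.
have dA := dim_capv_orthov1 (memv_pick A) v0.
have [|s os span_s] := IHr (A :&: <[vpick A]>^⊥)%VS; first by lia.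
exists (vpick A :: s).
  move: os => /andP[s0 os]; rewrite /pairwise_orthogonal inE eq_sym negb_or v0 s0.
  rewrite /= os !andbT; apply/allP=> x xs /=.
  have : x \in (A :&: <[vpick A]>^⊥)%VS by rewrite -span_s memv_span.
  by rewrite memv_cap mem_orthov1 => /andP[_]; rewrite dot_eq0C.
rewrite span_cons span_s capvC vspace_modl -?memvE ?memv_pick // addv_orthov.
by rewrite capfv.
Qed.

End Orthogonality.

Lemma sum_ord_const m c : (\sum_(j < m) c = m * c)%N.
Proof. by rewrite sum_nat_const card_ord. Qed.

Lemma eq_sum_lower m c (g : 'I_m -> nat) :
  (forall j, c <= g j)%N -> (\sum_j g j = m * c)%N -> forall j, g j = c.
Proof.
move=> ge_c sum_g j; apply/eqP; rewrite eqn_leq ge_c andbT.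
move: sum_g; rewrite -sum_ord_const !(bigD1 j (P := xpredT)) //= => sum_g.
rewrite -(leq_add2r (\sum_(i < m | i != j) c)%N) -sum_g leq_add2l.
exact: leq_sum.
Qed.

Lemma eq_sum_upper m c (g : 'I_m -> nat) :
  (forall j, g j <= c)%N -> (\sum_j g j = m * c)%N -> forall j, g j = c.
Proof.
move=> le_c sum_g j; apply/eqP; rewrite eqn_leq le_c /=.
move: sum_g; rewrite -sum_ord_const !(bigD1 j (P := xpredT)) //= => sum_g.
rewrite -(leq_add2r (\sum_(i < m | i != j) c)%N) -sum_g leq_add2l.
exact: leq_sum.
Qed.

(** * Images of the subspaces of a given subspace *)

Section Grassmann.
Variables (C : numClosedFieldType) (H : vectType C).
Variable dot : {dot H for Num.conj}.
Implicit Types (A B U V W X Y Z S : {vspace H}) (u v w : H).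

Local Notation "A ^⊥" := (orthov dot A) (at level 2, format "A ^⊥").
Let n := \dim {:H}.

(** Orthogonal bases of [Z] and of its complement are concatenated; indices are read modulo [n], so
    that runs of consecutive vectors wrap around. *)
Lemma cyclic_orthogonal_basis Z : (0 < n)%N -> exists e : nat -> H,
  [/\ forall j, e j != 0, forall j, e (j + n)%N = e j,
      forall j d, (0 < d < n)%N -> dot (e (j + d)%N) (e j) = 0
    & forall t, (t < \dim Z)%N -> e t \in Z].
Proof.
move=> n_gt0.
have [s os span_s] := orthogonal_basis dot Z.
have [s' os' span_s'] := orthogonal_basis dot Z^⊥.
have size_s : size s = \dim Z.
  by rewrite -span_s; apply/esym/eqP; exact: orthogonal_free os.
have size_s' : size s' = \dim Z^⊥.
  by rewrite -span_s'; apply/esym/eqP; exact: orthogonal_free os'.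
have oss' : pairwise_orthogonal dot (s ++ s').
  rewrite pairwise_orthogonal_cat os os' orthogonalE span_s span_s'.
  by rewrite orthov_sym subvv.
have size_ss' : size (s ++ s') = n.
  rewrite size_cat size_s size_s' dim_orthov subnKC //.
  exact: dimvS (subvf _).
have /pairwise_orthogonalP [/andP[ss'0 uniq_ss'] o_ss'] := oss'.
have mem_ss' j : (s ++ s')`_(j %% n) \in s ++ s'.
  by rewrite mem_nth // size_ss' ltn_mod.
exists (fun j => (s ++ s')`_(j %% n)); split=> [j|j|j d /andP[d0 dn]|t lt_t].
- by apply: contraNneq ss'0 => <-.
- by rewrite modnDr.
- rewrite o_ss' // nth_uniq ?size_ss' ?ltn_mod //.
  rewrite -[X in X == _]/((j + d) %% n)%N eqn_mod_dvd ?leq_addr // addKn.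
  by rewrite gtnNdvd.
- rewrite modn_small; last first.
    by rewrite (leq_trans lt_t) // (dimvS (subvf _)).
  by rewrite nth_cat size_s lt_t -span_s memv_span // mem_nth // size_s.
Qed.

Variables (k : nat) (F : {vspace H} -> {vspace H}).
Hypothesis k_gt0 : (0 < k)%N.
Hypothesis n_gt2k : (2 * k < n)%N.
Hypothesis dimF : forall X, \dim X = k -> \dim (F X) = k.
Hypothesis F_inj : forall X Y, \dim X = k -> \dim Y = k -> F X = F Y -> X = Y.
Hypothesis F_orth : forall X Y, \dim X = k -> \dim Y = k ->
  (X <= Y^⊥)%VS -> (F X <= (F Y)^⊥)%VS.

(** * Dimensions of cyclic arcs *)

Section Arcs.
Variable e : nat -> H.
Hypothesis e_neq0 : forall j, e j != 0.
Hypothesis e_period : forall j, e (j + n)%N = e j.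
Hypothesis e_orth : forall j d, (0 < d < n)%N -> dot (e (j + d)%N) (e j) = 0.

Definition window j := (\sum_(t < k) <[e (j + t)]>)%VS.
(** An arc of length [r] has [r.+1] windows, which involve [k + r] consecutive basis vectors. *)
Definition arc_span j r := (\sum_(t < r.+1) F (window (j + t)))%VS.
Let l j r := \dim (arc_span j r).
Let u r := (\sum_(j < n) l j r)%N.

Lemma dim_window j : \dim (window j) = k.
Proof.
rewrite (dim_sum_orth (V := fun t => <[e (j + t)]>%VS) (dot := dot)).
  rewrite -[RHS]card_ord -sum1_card; apply: eq_bigr => t _.
  by rewrite dim_vline e_neq0.
move=> t t' /andP[lt_t lt_t']; rewrite orth_lines.
have -> : (j + t' = j + t + (t' - t))%N by lia.
by rewrite e_orth //; lia.
Qed.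

(** The two windows use disjoint sets of indices on the cycle; the upper bound on [d] excludes an
    overlap around its end. *)
Lemma window_orth j d : (k <= d <= n - k)%N ->
  (window (j + d) <= (window j)^⊥)%VS.
Proof.
move=> /andP[le_kd le_dn]; apply/subv_sumP=> t _; rewrite orthov_sym.
apply/subv_sumP=> t' _; rewrite orth_lines dot_eq0C.
have -> : (j + d + t = j + t' + (d + t - t'))%N by have := ltn_ord t'; lia.
by rewrite e_orth //; move: (ltn_ord t) (ltn_ord t'); lia.
Qed.

Lemma Fwindow_orth j d : (k <= d <= n - k)%N ->
  (F (window (j + d)) <= (F (window j))^⊥)%VS.
Proof. by move=> le_d; rewrite F_orth ?dim_window // window_orth. Qed.

Lemma window_period j : window (j + n) = window j.
Proof. by apply: eq_bigr => t _; rewrite addnAC e_period. Qed.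

Lemma window_neq j : window j != window j.+1.
Proof.
have e_j : e j \in window j.
  rewrite memvE (sumv_sup (Ordinal k_gt0)) //= addn0 subvv //.
apply/negP => /eqP eq_w; have : e j \in (window j.+1)^⊥.
  apply/in_orthP => x /memv_sumP[v vP ->].
  rewrite dot_sumr big1 // => t _ /=.
  have /vlineP[c ->] := vP t isT.
  have /eqP : dot (e (j + t.+1)%N) (e j) = 0.
    by rewrite e_orth //; have := ltn_ord t; lia.
  by rewrite dotZr addSnnS dot_eq0C => /eqP->; rewrite mulr0.
rewrite -eq_w => /in_orthP/(_ _ e_j)/eqP.
by rewrite dnorm_eq0 (negbTE (e_neq0 j)).
Qed.

Lemma arc_spanSr j r : arc_span j r.+1 = (arc_span j r + F (window (j + r.+1)))%VS.
Proof. by rewrite /arc_span big_ord_recr. Qed.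

Lemma arc_spanSl j r : arc_span j r.+1 = (F (window j) + arc_span j.+1 r)%VS.
Proof.
rewrite /arc_span big_ord_recl /= addn0; congr (_ + _)%VS.
by apply: eq_bigr => t _; rewrite addSnnS.
Qed.

(** Two overlapping arcs of length [r.+1] span the longer one, and their intersection contains the
    span of the common windows. *)
Lemma dim_arc_spanS j r :
  (l j r.+2 + l j.+1 r <= l j r.+1 + l j.+1 r.+1)%N.
Proof.
rewrite /l -[leqRHS]dimv_sum_cap; apply: leq_add; apply: dimvS.
  by rewrite {1}arc_spanSl addvS // arc_spanSl addvSl.
by rewrite subv_cap arc_spanSl addvSr arc_spanSr addvSl.
Qed.

Lemma sum_dim_arc_shift (d r : nat) : (\sum_(j < n) l (j + d) r)%N = u r.
Proof.
elim: d => [|d <-]; first by apply: eq_bigr => j _; rewrite addn0.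
have n_gt0 : (0 < n)%N by lia.
rewrite -!(big_mkord xpredT (fun j => l (j + _) r)) -(prednK n_gt0).
rewrite big_nat_recr //= [in RHS]big_nat_recl //= addnC; congr (_ + _)%N.
  rewrite /l /arc_span; congr (\dim _); apply: eq_bigr => t _.
  by rewrite -[in RHS]window_period; congr (F (window _)); lia.
by apply: eq_bigr => j _; rewrite addSnnS.
Qed.

Lemma dim_arc_mod j r : l (j %% n) r = l j r.
Proof.
rewrite [in RHS](divn_eq j n) addnC; elim: (j %/ n)%N => [|q IHq].
  by rewrite mul0n addn0.
rewrite {}IHq mulSn (addnC n) addnA /l /arc_span; congr (\dim _).
by apply: eq_bigr => t _; rewrite [in RHS]addnAC window_period.
Qed.

(** Each window of the second arc is between [k] and [n - k] steps ahead of each window of the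
    first, so the spans are orthogonal. *)
Lemma dim_arc_orth j r r' : (r + r' + 2 * k <= n)%N ->
  (l j r + l (j + (r + k)) r' <= n)%N.
Proof.
move=> le_n; rewrite /l -(@dim_addv_orth _ _ dot); first exact: dimvS (subvf _).
apply/subv_sumP=> t _; rewrite orthov_sym; apply/subv_sumP=> t' _.
move: (ltn_ord t) (ltn_ord t') => lt_t lt_t'.
have -> : (j + (r + k) + t' = j + t + (r + k + t' - t))%N by lia.
by rewrite Fwindow_orth //; lia.
Qed.

Lemma sum_dim_arc_orth r r' : (r + r' + 2 * k <= n)%N ->
  (u r + u r' <= n * n)%N.
Proof.
move=> le_n; rewrite -(sum_dim_arc_shift (r + k) r') -big_split /=.
rewrite -(sum_ord_const n n); apply: leq_sum => j _.
exact: dim_arc_orth.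
Qed.

Lemma dim_arc0 j : l j 0 = k.
Proof. by rewrite /l /arc_span big_ord1 addn0 dimF ?dim_window. Qed.

(** The windows at [j], [j + k], ..., [j + q * k] belong to this arc and have pairwise orthogonal
    images. *)
Lemma dim_arc_disjoint j q : (q.+1 * k <= n)%N -> (q.+1 * k <= l j (q * k))%N.
Proof.
move=> le_n.
have <- : \dim (\sum_(t < q.+1) F (window (j + t * k)))%VS = (q.+1 * k)%N.
  rewrite (dim_sum_orth (V := fun t => F (window (j + t * k))) (dot := dot)).
    rewrite -[RHS]sum_ord_const; apply: eq_bigr => t _.
    by rewrite dimF ?dim_window.
  move=> t t' /andP[lt_t lt_t'].
  have -> : (j + t' * k = j + t * k + (t' - t) * k)%N.
    by rewrite -addnA -mulnDl subnKC // ltnW.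
  apply: Fwindow_orth; rewrite leq_pmull ?subn_gt0 //= leq_subRL; last first.
    by apply: leq_trans le_n; rewrite leq_pmull.
  by rewrite -mulSn; apply: leq_trans le_n; rewrite leq_mul2r; apply/orP; right; lia.
apply: dimvS; apply/subv_sumP=> t _.
have lt_t : (t * k < (q * k).+1)%N by rewrite ltnS leq_mul2r -ltnS ltn_ord orbT.
exact: (sumv_sup (Ordinal lt_t)).
Qed.

(** The chord of slope [n] runs from 0 to [q * k], where [q.+1] is the quotient of [n] by [k];
    [dim_arc_disjoint] gives the bound at its end. *)
Lemma sum_dim_arc_ge r : (r + 2 * k <= n)%N -> (n * (k + r) <= u r)%N.
Proof.
move=> le_r; have u0 : u 0 = (n * k)%N.
  rewrite /u (eq_bigr (fun=> k)) => [|j _]; last exact: dim_arc0.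
  by rewrite sum_ord_const.
have n_k := divn_eq n k; have lt_k := ltn_pmod n k_gt0.
case def_q : (n %/ k)%N n_k => [|q] n_k; first by move: n_gt2k; lia.
rewrite mulnDr -u0.
apply: (@concave_above_chord _ _ (q * k)%N) => [r1||].
- have split_u q1 q2 : (u q1 + u q2 = \sum_(j < n) (l j q1 + l (j + 1) q2))%N.
    by rewrite big_split /= sum_dim_arc_shift.
  rewrite !split_u.
  by apply: leq_sum => j _; rewrite addn1 dim_arc_spanS.
- rewrite u0 -mulnDr -mulSn -sum_ord_const.
  by apply: leq_sum => j _; apply: dim_arc_disjoint; lia.
(* Since [n < q.+2 * k], every [r <= n - 2 * k] lies within the chord. *)
- by move: n_k le_r; rewrite mulSn; lia.
Qed.

(** With [r' = n - 2 * k - r], the lower bounds at [r] and [r'] add up to [n * n], the upper bound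
    for the sum, so both are equalities. *)
Lemma sum_dim_arc r : (r + 2 * k <= n)%N -> u r = (n * (k + r))%N.
Proof.
move=> le_r; have ge_r := sum_dim_arc_ge le_r.
have [r' def_r'] : exists r', (r + r' + 2 * k = n)%N.
  by exists (n - 2 * k - r)%N; lia.
have le_rr' : (r + r' + 2 * k <= n)%N by rewrite def_r'.
have ge_r' : (n * (k + r') <= u r')%N by apply: sum_dim_arc_ge; lia.
have eq_n : (n * (k + r) + n * (k + r') = n * n)%N.
  by rewrite -mulnDr; congr (_ * _)%N; lia.
by have := sum_dim_arc_orth le_rr'; lia.
Qed.

(** Adjacent windows have distinct images by injectivity, so each term is at least [k.+1]; the sum
    leaves no room for more. *)
Lemma dim_arc1 j : (j < n)%N -> l j 1 = k.+1.
Proof.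
have sum_l : (\sum_(j < n) l j 1 = n * k.+1)%N.
  by rewrite -[LHS]/(u 1) sum_dim_arc ?addn1 //; lia.
move=> lt_j; apply: (eq_sum_lower (g := fun j : 'I_n => l j 1) _ sum_l (Ordinal lt_j)).
move=> i; rewrite /l arc_spanSr ltnNge; apply/negP => le_k.
have d0 := dim_arc0 i; have d1 := dimF (dim_window (i + 1)).
have /eqP eq0 : (arc_span i 0 == arc_span i 0 + F (window (i + 1)))%VS.
  by rewrite eqEdim addvSl -/(l i 0) d0.
have : (F (window (i + 1)) == arc_span i 0)%VS.
  by rewrite eqEdim {1}eq0 addvSr d1 -/(l i 0) d0 leqnn.
rewrite /arc_span big_ord1 addn0 addn1 => /eqP/F_inj/eqP.
by rewrite !dim_window eq_sym (negbTE (window_neq i)) => /(_ erefl erefl).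
Qed.

(** By submodularity an increment is at most that of the next, one step shorter arc, and so on down
    to [dim_arc1]. *)
Lemma dim_arc_step j r : (l j r.+1 <= (l j r).+1)%N.
Proof.
elim: r j => [|r IHr] j.
  rewrite dim_arc0 -(dim_arc_mod j); apply: eq_leq; apply: dim_arc1.
  by rewrite ltn_mod; lia.
by have := dim_arc_spanS j r; have := IHr j.+1; lia.
Qed.

Lemma dim_arc j r : (j < n)%N -> (r + 2 * k <= n)%N -> l j r = (k + r)%N.
Proof.
move=> lt_j le_r.
apply: (eq_sum_upper (g := fun j : 'I_n => l j r) _ _ (Ordinal lt_j)) => [i|].
  by elim: r {le_r} => [|r IHr]; [rewrite dim_arc0; lia | have := dim_arc_step i r; lia].
exact: sum_dim_arc.
Qed.

End Arcs.

(** * Propagation to subspaces of larger dimension *)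

Definition contains_images Z G :=
  forall X, \dim X = k -> (X <= Z)%VS -> (F X <= G)%VS.

(** In a cyclic basis adapted to [Z], the arc from 0 of length [\dim Z - k] consists of windows
    inside [Z], and [dim_arc] gives the dimension of its span. *)
Lemma images_span_dim Z : (k <= \dim Z <= n - k)%N ->
  exists2 W, \dim W = \dim Z & forall G, contains_images Z G -> (W <= G)%VS.
Proof.
move=> /andP[le_kZ le_Zn].
have [|e [e0 e_period e_orth eZ]] := cyclic_orthogonal_basis Z; first by lia.
exists (arc_span e 0 (\dim Z - k)).
  by rewrite dim_arc ?subnKC //; lia.
move=> G GZ; apply/subv_sumP => t _; apply: GZ; first exact: dim_window.
apply/subv_sumP => t' _; rewrite -memvE eZ //.
by have := (ltn_ord t); have := (ltn_ord t'); lia.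
Qed.

(** The subspace [W] obtained for [Z^⊥] is orthogonal to all images from [Z], so [W^⊥] serves. *)
Lemma images_bound Z : (k <= \dim Z <= n - k)%N ->
  exists2 G, \dim G = \dim Z & contains_images Z G.
Proof.
move=> dimZ; have := dimvS (subvf Z).
have [|W dimW WG] := @images_span_dim Z^⊥; first by rewrite dim_orthov; lia.
move=> le_Zn; exists W^⊥; first by rewrite dim_orthov dimW dim_orthov; lia.
move=> X dimX XZ; rewrite orthov_sym; apply: WG => Y dimY YZ.
apply: F_orth => //; rewrite orthov_sym; apply: subv_trans XZ _.
by rewrite orthov_sym.
Qed.

(** The images from [X + Y] lie in some [G] of dimension [k.+1], which [F X + F Y] fills because
    [F X] and [F Y] differ. *)
Lemma adjacent_images X Y : \dim X = k -> \dim Y = k -> \dim (X + Y) = k.+1 ->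
  \dim (F X + F Y) = k.+1 /\ contains_images (X + Y) (F X + F Y).
Proof.
move=> dimX dimY dimXY.
have [|G dimG GXY] := @images_bound (X + Y)%VS; first by lia.
have sFG : (F X + F Y <= G)%VS by rewrite subv_add !GXY ?addvSl ?addvSr.
have dFXY : \dim (F X + F Y) = k.+1.
  apply/eqP; rewrite eqn_leq -{1}dimXY -dimG dimvS //= ltnNge.
  apply/negP => le_k.
  have eqX : F X = (F X + F Y)%VS.
    by apply/eqP; rewrite eqEdim addvSl dimF.
  have eqY : F Y = (F X + F Y)%VS.
    by apply/eqP; rewrite eqEdim addvSr dimF.
  have /F_inj eqXY : F X = F Y by rewrite eqX -eqY.
  by move: dimXY; rewrite eqXY // addvv dimY; lia.
split=> // Z dimZ ZXY; have /eqP-> : (F X + F Y)%VS == G.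
  by rewrite eqEdim sFG dimG dimXY dFXY leqnn.
exact: GXY.
Qed.

(* If X is not in Z' and differs from X0, then X lies in the span of two distinct
   adjacent k-subspaces, one in Z' and one closer to X0 than X. *)
Lemma contains_images_hyperplane Z Z' G' X0 :
    (Z' <= Z)%VS -> (\dim Z <= (\dim Z').+1)%N -> contains_images Z' G' ->
    \dim X0 = k -> (X0 <= Z)%VS -> ~~ (X0 <= Z')%VS ->
  contains_images Z (G' + F X0).
Proof.
move=> sZ'Z dimZ imG' dimX0 X0Z X0Z' X dimX XZ.
have [XZ'|] := boolP (X <= Z')%VS.
  by apply: subv_trans (addvSl _ _); exact: imG'.
have [r] := ubnP (k - \dim (X :&: X0))%N.
elim: r X dimX XZ => // r IHr X dimX XZ lt_r XZ'.
have lt_sub a b : (a < b -> a < k -> k - a < r.+1 -> k - b < r)%N by clear; lia.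
have [X0X|X0X] := boolP (X0 <= X)%VS.
  have /eqP-> : X == X0 by rewrite eq_sym eqEdim X0X dimX0 dimX /=.
  exact: addvSr.
have [y [yX0 yX yZ']] := not_subv_union X0X X0Z'.
have lt_k : (\dim (X :&: X0) < k)%N.
  rewrite ltnNge; apply: contra X0X => le_k.
  suff /eqP <- : (X :&: X0)%VS == X0 by rewrite capvSl.
  by rewrite eqEdim capvSr dimX0.
have [|Q [IQ QX dimQ]] := @vspace_of_dim _ _ (X :&: X0)%VS X k.-1 (capvSl _ _).
  by rewrite dimX; lia.
(* [X1] keeps [X :&: X0] and gains [y] from [X0], so the induction applies to it. *)
pose X1 := (Q + <[y]>)%VS.
have yQ : y \notin Q by apply: contra yX => /(subvP QX).
have dimX1 : \dim X1 = k by rewrite dim_add_line_notin // dimQ prednK.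
have yX1 : y \in X1 by rewrite memvE addvSr.
have X1Z : (X1 <= Z)%VS.
  by rewrite subv_add (subv_trans QX XZ) -memvE (subvP X0Z).
have X1Z' : ~~ (X1 <= Z')%VS by apply: contra yZ' => /subvP; exact.
have FX1 : (F X1 <= G' + F X0)%VS.
  apply: IHr => //; apply: lt_sub lt_k lt_r.
  rewrite -(@dim_add_line_notin _ _ _ y) ?memv_cap ?negb_and ?yX //.
  apply: dimvS; rewrite subv_add subv_cap capvSr -memvE memv_cap yX1 yX0 !andbT.
  exact: subv_trans IQ (addvSl _ _).
pose S := (X + <[y]>)%VS.
have dimS : \dim S = k.+1 by rewrite dim_add_line_notin // dimX.
have SZ : (S <= Z)%VS by rewrite subv_add XZ -memvE (subvP X0Z).
(* As [Z'] has codimension at most one in [Z], some [k]-subspace [X2] lies in both [S] and [Z']; it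
   differs from [X1] and spans [S] with it. *)
have dimSZ' : (k <= \dim (S :&: Z'))%N.
  have := dimv_sum_cap S Z'; rewrite dimS.
  have : (\dim (S + Z') <= \dim Z)%N by rewrite dimvS // subv_add SZ.
  by move: dimZ; clear; lia.
have [|X2 [_]] := @vspace_of_dim _ _ 0%VS (S :&: Z')%VS k (sub0v _).
  by rewrite dimv0.
rewrite subv_cap => /andP[X2S X2Z'] dimX2.
have X12S : (X1 + X2)%VS = S.
  apply/eqP; rewrite eqEdim dimS subv_add X2S andbT.
  rewrite (addvS QX (subvv _)) /= ltnNge; apply: contra X1Z' => le_k.
  apply: subv_trans X2Z'; apply: subv_trans (addvSl _ X2) _.
  suff /eqP <- : X2 == (X1 + X2)%VS by rewrite subvv.
  by rewrite eqEdim addvSr dimX2.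
have [|_ /(_ X dimX)] := adjacent_images dimX1 dimX2; first by rewrite X12S.
rewrite X12S addvSl => /(_ isT) FX; apply: subv_trans FX _.
rewrite subv_add FX1 /=; apply: subv_trans (addvSl _ _); exact: imG'.
Qed.

Lemma dim_addv_submod A A' B : (A' <= A)%VS ->
  (\dim (A + B) + \dim A' <= \dim A + \dim (A' + B))%N.
Proof.
move=> sA'A; have := dimv_sum_cap A B; have := dimv_sum_cap A' B.
have : (\dim (A' :&: B) <= \dim (A :&: B))%N by rewrite dimvS // capvS.
by lia.
Qed.

(** By induction on the dimension, from a hyperplane [Z'] of [Z] and some [X0] outside it. A
    [k]-subspace [X1] of [Z'] adjacent to [X0] shows that [F X0] adds at most one dimension to
    [G']. *)
Lemma images_bound_large Z : (k <= \dim Z)%N ->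
  exists2 G, (\dim G <= \dim Z)%N & contains_images Z G.
Proof.
move=> /subnKC; move: (\dim Z - k)%N => r; elim: r Z => [|r IHr] Z dimZ.
  exists (F Z) => [|X dimX XZ]; first by rewrite dimF // -dimZ addn0.
  suff /eqP-> : X == Z by [].
  by rewrite eqEdim XZ dimX -dimZ addn0 /=.
have [|Z' [_ Z'Z dimZ']] := @vspace_of_dim _ _ 0%VS Z (k + r)%N (sub0v _).
  by rewrite dimv0 -dimZ; lia.
have [G' dimG' imG'] := IHr Z' (esym dimZ').
have /subvPn[v vZ vZ'] : ~~ (Z <= Z')%VS by apply/negP => /dimvS; lia.
have v0 : v != 0 by apply: contraNneq vZ' => ->; rewrite mem0v.
have [||X0 [vX0 X0Z dimX0]] := @vspace_of_dim _ _ <[v]>%VS Z k.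
- by rewrite -memvE.
- by rewrite dim_vline v0; lia.
have X0Z' : ~~ (X0 <= Z')%VS.
  by apply: contra vZ' => /subvP; apply; rewrite memvE.
exists (G' + F X0)%VS; last first.
  by apply: contains_images_hyperplane Z'Z _ imG' _ X0Z X0Z' => //; lia.
have dimM : \dim (X0 :&: Z') = k.-1.
  have := dimv_sum_cap X0 Z'; rewrite dimX0 dimZ'.
  have : (\dim (X0 + Z') <= \dim Z)%N by rewrite dimvS // subv_add X0Z.
  have : (\dim (X0 :&: Z') < k)%N.
    rewrite ltnNge; apply: contra X0Z' => le_k.
    suff /eqP <- : (X0 :&: Z')%VS == X0 by rewrite capvSr.
    by rewrite eqEdim capvSl dimX0.
  by move: dimZ k_gt0; clear; lia.
have [|X1 [MX1 X1Z' dimX1]] := @vspace_of_dim _ _ _ Z' k (capvSr X0 Z').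
  by rewrite dimM; lia.
have dimX10 : \dim (X1 + X0) = k.+1.
  have capE : (X1 :&: X0 = X0 :&: Z')%VS.
    apply/eqP; rewrite eqEsubv !subv_cap capvSr capvSl MX1 !andbT /=.
    exact: subv_trans (capvSl _ _) X1Z'.
  by have := dimv_sum_cap X1 X0; rewrite capE; lia.
have [dimF10 _] := adjacent_images dimX1 dimX0 dimX10.
have := dim_addv_submod (F X0) (imG' X1 dimX1 X1Z').
by rewrite dimF10 dimF //; lia.
Qed.

(** As [<[v]>^⊥] is a hyperplane for nonzero [v], the bound on its images leaves room for a nonzero
    orthogonal vector. Zero is sent to zero, so that a total map can be chosen. *)
Lemma orth_line_exists v : exists w,
  (w == 0) = (v == 0) /\
  forall X, \dim X = k -> (X <= <[v]>^⊥)%VS -> w \in (F X)^⊥.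
Proof.
have [->|v0] := eqVneq v 0.
  by exists 0; rewrite !eqxx; split=> // X _ _; rewrite mem0v.
have [|G dimG imG] := @images_bound_large <[v]>^⊥.
  by rewrite dim_orthov dim_vline v0; lia.
exists (vpick G^⊥); split=> [|X dimX Xv].
  rewrite vpick0 -dimv_eq0 dim_orthov; apply/negbTE.
  by move: dimG; rewrite dim_orthov dim_vline v0; lia.
by apply: (subvP (orthovS dot (imG X dimX Xv))); exact: memv_pick.
Qed.

Lemma line_map_exists : exists h : H -> H,
  [/\ forall v, (h v == 0) = (v == 0),
      forall v X, \dim X = k -> v \in X -> h v \in F X
    & forall v w, dot v w = 0 -> dot (h v) (h w) = 0].
Proof.
have [h hP] := choice orth_line_exists.
have h0 v : (h v == 0) = (v == 0) by case: (hP v).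
have hF v X : \dim X = k -> v \in X -> h v \in F X.
  move=> dimX vX; have le_kn := dimvS (subvf X).
  (* [W] is forced by the images from [X^⊥] and equals [(F X)^⊥] by dimension; [h v] is orthogonal
     to those images, hence in [F X]. *)
  have [|W dimW WG] := @images_span_dim X^⊥; first by rewrite dim_orthov; lia.
  have WX : W = (F X)^⊥.
    apply/eqP; rewrite eqEdim WG ?dim_orthov ?dimF ?dimW ?dim_orthov ?dimX ?leqnn //.
    by move=> Y dimY YX; exact: F_orth.
  have Wh : (W <= <[h v]>^⊥)%VS.
    apply: WG => Y dimY YX; rewrite orthov_sym -memvE.
    have [_] := hP v; apply=> //; apply: subv_trans YX _.
    by apply: orthovS; rewrite -memvE.
  by rewrite -(orthovK dot (F X)) -WX memvE orthov_sym.
exists h; split=> // v w vw.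
have [v0|v0] := eqVneq v 0.
  by have /eqP-> : h v == 0; rewrite ?h0 ?v0 // dot0l.
have [w0|w0] := eqVneq w 0.
  by apply/eqP; rewrite dot_eq0C; have /eqP-> : h w == 0; rewrite ?h0 ?w0 // dot0l.
(* For [X] through [v] inside [<[w]>^⊥], [h v] lies in [F X] and [h w] is orthogonal to [F X]. *)
have [||X [vX Xw dimX]] := @vspace_of_dim _ _ <[v]>%VS <[w]>^⊥ k.
- by rewrite orth_lines vw.
- by rewrite dim_orthov !dim_vline v0 w0; lia.
have [_ /(_ X dimX Xw)/in_orthP hw] := hP w.
by apply/eqP; rewrite dot_eq0C hw // hF // memvE.
Qed.

End Grassmann.

(** * The induced map on lines *)

Section LineMap.
Variables (C : numClosedFieldType) (H : vectType C).
Variable dot : {dot H for Num.conj}.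
Variables (k : nat) (F : {vspace H} -> {vspace H}) (h : H -> H).
Hypothesis n_gt2k : (2 * k < \dim {:H})%N.
Hypothesis k_gt0 : (0 < k)%N.
Hypothesis dimF : forall X, \dim X = k -> \dim (F X) = k.
Hypothesis F_inj : forall X Y, \dim X = k -> \dim Y = k -> F X = F Y -> X = Y.
Hypothesis h_eq0 : forall v, (h v == 0) = (v == 0).
Hypothesis h_in : forall v X, \dim X = k -> v \in X -> h v \in F X.
Hypothesis h_orth : forall v w, dot v w = 0 -> dot (h v) (h w) = 0.

Lemma pairwise_orthogonal_map s :
  pairwise_orthogonal dot s -> pairwise_orthogonal dot (map h s).
Proof.
case/andP=> s0 os; apply/andP; split.
  apply: contra s0 => /mapP[v vs /esym/eqP]; rewrite h_eq0 => /eqP v0.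
  by rewrite -v0.
elim: s os {s0} => //= v s IHs; rewrite !andbT => /andP[/allP vs /IHs->].
rewrite andbT; apply/allP => _ /mapP[w ws ->] /=.
by apply/eqP; apply: h_orth; apply/eqP; exact: vs.
Qed.

(** The [k] vectors of [map h s] lie in [F <<s>>] and are free, being nonzero and pairwise
    orthogonal. This serves again with a semilinear map for [h]. *)
Lemma image_of_span s : pairwise_orthogonal dot s -> size s = k ->
  F <<s>> = <<map h s>>%VS.
Proof.
move=> os size_s.
have dim_s : \dim <<s>> = k by rewrite (eqP (orthogonal_free os)).
have free_hs := orthogonal_free (pairwise_orthogonal_map os).
apply/esym/eqP; rewrite eqEdim dimF // (eqP free_hs).
rewrite size_map size_s leqnn andbT; apply/span_subvP => _ /mapP[v vs ->].
by apply: h_in; rewrite // memv_span.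
Qed.

(* Otherwise M + <[v]> and M + <[w]> have the same image under F, for any
   (k-1)-dimensional subspace M orthogonal to v and w. *)
Lemma line_map_inj v w : v != 0 -> w != 0 ->
  h v \in <[h w]>%VS -> v \in <[w]>%VS.
Proof.
move=> v0 w0 hvw; apply/negPn/negP => vw.
pose D := (<[w]> + <[v]>)%VS.
have dimD : \dim D = 2 by rewrite dim_add_line_notin // dim_vline w0.
have [|M [_ MD dimM]] := @vspace_of_dim _ _ 0%VS (orthov dot D) k.-1 (sub0v _).
  by rewrite dimv0 dim_orthov dimD; move: n_gt2k; clear; lia.
have [s os span_s] := orthogonal_basis dot M.
have size_s : size s = k.-1.
  by rewrite -dimM -span_s; apply/esym/eqP; exact: orthogonal_free os.
have frame x : x != 0 -> x \in D ->
    pairwise_orthogonal dot (x :: s) /\ size (x :: s) = k.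
  move=> x0 xD; split; last by rewrite /= size_s prednK.
  case/andP: os => s0 os; rewrite /pairwise_orthogonal inE eq_sym negb_or x0 s0.
  rewrite /= os !andbT; apply/allP => y ys /=; rewrite dot_eq0C; apply/eqP.
  have /in_orthP : y \in orthov dot D by rewrite (subvP MD) // -span_s memv_span.
  exact.
have vD : v \in D by rewrite memvE addvSr.
have wD : w \in D by rewrite memvE addvSl.
have [osv sizev] := frame v v0 vD; have [osw sizew] := frame w w0 wD.
have eq_line : <[h v]>%VS = <[h w]>%VS.
  by apply/eqP; rewrite eqEdim -memvE hvw !dim_vline !h_eq0 v0 w0.
have : F <<v :: s>> = F <<w :: s>>.
  by rewrite !image_of_span // !map_cons !span_cons eq_line.
move=> /F_inj eq_span.
have dimvs : \dim <<v :: s>> = k by rewrite (eqP (orthogonal_free osv)).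
have dimws : \dim <<w :: s>> = k by rewrite (eqP (orthogonal_free osw)).
(* A [k]-dimensional span would contain [D + M], of dimension [k.+1]. *)
have : (D + M <= <<w :: s>>)%VS.
  rewrite subv_add subv_add span_cons addvSl span_s addvSr andbT /=.
  by rewrite -span_s -span_cons -eq_span // span_cons addvSl.
move/dimvS; rewrite dimws (@dim_addv_orth _ _ dot); last by rewrite orthov_sym.
by rewrite dimD dimM; move: k_gt0; clear; lia.
Qed.

End LineMap.

(* st_orth expresses the preservation of the orthogonality of (1, a, b) and the
   conjugate of (1, x, y).  The product s1 a * t1 x
   depends only on a * x; as a function of a * x it is multiplicative, and it
   satisfies coord_prod (1 + p) = 1 + coord_prod p, hence it is additive. *)
Section OrthogonalityPreservingCoordinates.
Variables (K : fieldType) (s1 t1 s2 t2 : K -> K).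
Hypothesis s1_0 : s1 0 = 0.
Hypothesis s2_0 : s2 0 = 0.
Hypothesis s1_odd : s1 (-1) != s1 1.
Hypothesis s2_odd : s2 (-1) != s2 1.
Hypothesis st_orth : forall a x b y, 1 + a * x + b * y = 0 ->
  1 + s1 a * t1 x + s2 b * t2 y = 0.

Definition coord_prod p := s1 p * t1 1.

(** The pairs [(a, x)] and [(a * x, 1)] satisfy the relation with the same [b] and [y]. *)
Lemma coord_prodE a x : s1 a * t1 x = coord_prod (a * x).
Proof.
have E1 : 1 + a * x + 1 * (- 1 - a * x) = 0 by ring.
have E2 : 1 + a * x * 1 + 1 * (- 1 - a * x) = 0 by ring.
have := st_orth E2; rewrite -{1}(st_orth E1) => /addIr/addrI.
by rewrite /coord_prod.
Qed.

Lemma coord_prod_N1 : coord_prod (-1) = -1.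
Proof.
have E : 1 + (-1) * 1 + 0 * 0 = 0 :> K by ring.
by have := st_orth E; rewrite s2_0 mul0r addr0 addrC => /eqP; rewrite addr_eq0 => /eqP.
Qed.

Lemma coord_prodM1 p q : coord_prod p * coord_prod q = coord_prod (p * q) * coord_prod 1.
Proof.
have -> : coord_prod q = s1 1 * t1 q by rewrite coord_prodE mul1r.
by rewrite -(coord_prodE p q) /coord_prod; ring.
Qed.

(** The square is 1 by [coord_prodM1] at [-1]; the value [-1] would equal [coord_prod (-1)], against
    [s1_odd]. *)
Lemma coord_prod_1 : coord_prod 1 = 1.
Proof.
have /eqP : coord_prod 1 ^+ 2 = 1.
  have := coord_prodM1 (-1) (-1); rewrite coord_prod_N1 mulrNN mulr1 expr2.
  by move=> <-; ring.
rewrite sqrf_eq1 => /orP[/eqP //|/eqP E].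
have t1_neq0 : t1 1 != 0.
  apply: contra_eqN coord_prod_N1 => /eqP t10.
  by rewrite /coord_prod t10 mulr0 eq_sym oppr_eq0 oner_eq0.
case/negP: s1_odd; apply/eqP; apply: (mulIf t1_neq0).
by rewrite -[LHS]/(coord_prod (-1)) coord_prod_N1 -E.
Qed.

Lemma coord_prodM : {morph coord_prod : p q / p * q}.
Proof. by move=> p q; rewrite coord_prodM1 coord_prod_1 mulr1. Qed.

Lemma coord_prodN p : coord_prod (- p) = - coord_prod p.
Proof. by rewrite -mulN1r coord_prodM coord_prod_N1 mulN1r. Qed.

End OrthogonalityPreservingCoordinates.

Section AdditiveCoordinates.
Variables (K : fieldType) (s1 t1 s2 t2 : K -> K).
Hypothesis s1_0 : s1 0 = 0.
Hypothesis s2_0 : s2 0 = 0.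
Hypothesis s1_odd : s1 (-1) != s1 1.
Hypothesis s2_odd : s2 (-1) != s2 1.
Hypothesis st_orth : forall a x b y, 1 + a * x + b * y = 0 ->
  1 + s1 a * t1 x + s2 b * t2 y = 0.

Let P1 := coord_prod s1 t1.
Let P2 := coord_prod s2 t2.

Lemma st_orthC a x b y : 1 + a * x + b * y = 0 ->
  1 + s2 a * t2 x + s1 b * t1 y = 0.
Proof. by rewrite addrAC => /st_orth; rewrite addrAC. Qed.

Let P1M : {morph P1 : p q / p * q} := coord_prodM s2_0 s1_odd st_orth.
Let P2M : {morph P2 : p q / p * q} := coord_prodM s1_0 s2_odd st_orthC.
Let P1_1 : P1 1 = 1 := coord_prod_1 s2_0 s1_odd st_orth.
Let P2_1 : P2 1 = 1 := coord_prod_1 s1_0 s2_odd st_orthC.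

Lemma coord_prod_add1 p : P2 (1 + p) = 1 + P1 p.
Proof.
have E : 1 + p * 1 + (- (1 + p)) * 1 = 0 by ring.
have := st_orth E; rewrite -/(coord_prod s1 t1 p) -/(coord_prod s2 t2 _).
by rewrite (coord_prodN s1_0 s2_odd st_orthC) => /eqP; rewrite subr_eq0 => /eqP.
Qed.

(** [P2 (1 + p)] is both [1 + P1 p] and [P2 p * (1 + P1 p^-1)]. Multiplied by [P1 p], the latter
    becomes [P2 p * P2 (1 + p)], and [P2 (1 + p)] cancels; 0 and [-1] are treated apart. *)
Lemma coord_prod_eq p : P1 p = P2 p.
Proof.
have [->|p0] := eqVneq p 0; first by rewrite /P1 /P2 /coord_prod s1_0 s2_0 !mul0r.
have [->|p1] := eqVneq p (-1).
  rewrite /P1 (coord_prod_N1 s2_0 st_orth).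
  by rewrite /P2 (coord_prod_N1 s1_0 st_orthC).
have p1' : 1 + p != 0 by rewrite addrC addr_eq0.
have nz : P2 (1 + p) != 0.
  apply: contraTneq (oner_neq0 K) => Pp0.
  by rewrite -P2_1 -(mulfV p1') P2M Pp0 mul0r eqxx.
apply: (mulIf nz).
have {1}-> : P2 (1 + p) = P2 p * (1 + P1 p^-1).
  by rewrite -coord_prod_add1 -P2M mulrDr mulfV // mulr1 addrC.
rewrite coord_prod_add1 mulrCA; congr (_ * _).
by rewrite mulrDr mulr1 -P1M mulfV // P1_1 addrC.
Qed.

(** Writing [a + b = a * (1 + b / a)] reduces additivity to [coord_prod_add1], now about a single
    function. *)
Lemma coord_prodD : {morph P1 : a b / a + b}.
Proof.
move=> a b; have [->|a0] := eqVneq a 0.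
  by rewrite add0r [in RHS]/P1 /coord_prod s1_0 mul0r add0r.
have -> : a + b = a * (1 + b / a) by rewrite mulrDr mulr1 mulrC divfK.
rewrite P1M (coord_prod_eq (1 + b / a)) coord_prod_add1 mulrDr mulr1 -P1M.
by rewrite mulrC divfK.
Qed.

End AdditiveCoordinates.

Lemma conjC_opp_inv (C : numClosedFieldType) (a : C) :
  Num.conj (- (Num.conj a)^-1) = - a^-1.
Proof. by rewrite rmorphN /= fmorphV /= conjCK. Qed.

(** * Wigner's theorem for injective maps preserving orthogonality *)

Section OrthonormalFamily.
Variables (C : numClosedFieldType) (H : vectType C).
Variable dot : {dot H for Num.conj}.
Implicit Types (u v w : H).
Let n := \dim {:H}.

Definition normalize v := (sqrtC (dot v v))^-1 *: v.

Lemma dot_normalize v : v != 0 -> dot (normalize v) (normalize v) = 1.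
Proof.
move=> v0; have vv0 : dot v v != 0 by rewrite dnorm_eq0.
rewrite dnormZ normfV ger0_norm ?sqrtC_ge0 ?dnorm_ge0 // exprVn sqrtCK.
by rewrite mulVf.
Qed.

Definition orthonormal_family m (b : 'I_m -> H) :=
  forall i j, dot (b i) (b j) = (i == j)%:R.

Lemma dot_family m (b : 'I_m -> H) (c : 'I_m -> C) j :
  orthonormal_family b -> dot (\sum_i c i *: b i) (b j) = c j.
Proof.
move=> ob; rewrite dot_suml (bigD1 j) //= big1 => [|i /negbTE ij]; last first.
  by rewrite dotZl ob ij mulr0.
by rewrite dotZl ob eqxx mulr1 addr0.
Qed.

Lemma dot_family2 m (b : 'I_m -> H) (c d : 'I_m -> C) :
  orthonormal_family b ->
  dot (\sum_i c i *: b i) (\sum_i d i *: b i) = \sum_i c i * Num.conj (d i).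
Proof.
move=> ob; rewrite dot_sumr; apply: eq_bigr => i _.
by rewrite dotZr dot_family // mulrC.
Qed.

Lemma family_expand (b : 'I_n -> H) v :
  orthonormal_family b -> v = \sum_i dot v (b i) *: b i.
Proof.
move=> ob; pose X := [tuple b i | i < n].
have XE (i : 'I_n) : X`_i = b i by rewrite -tnth_nth tnth_mktuple.
have free_X : free X.
  apply/freeP => c c0 i; rewrite -(dot_family c i ob).
  have -> : \sum_i0 c i0 *: b i0 = 0; last by rewrite dot0l.
  by rewrite -[RHS]c0; apply: eq_bigr => j _; rewrite XE.
have vX : v \in <<X>>%VS.
  suff /eqP -> : (<<X>>%VS == fullv) by rewrite memvf.
  by rewrite eqEdim subvf (eqP free_X) size_tuple leqnn.
rewrite {1}(coord_span vX); apply: eq_bigr => i _; rewrite XE; congr (_ *: _).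
rewrite [in RHS](coord_span vX) -(dot_family (fun j => coord X j v) i ob).
by congr (dot _ _); apply: eq_bigr => j _; rewrite XE.
Qed.

Lemma orthonormal_family_exists : exists b : 'I_n -> H, orthonormal_family b.
Proof.
have [n0|n_gt0] := posnP n.
  by exists (fun=> 0) => i; have := leq_trans (ltn_ord i) (eq_leq n0).
have [e [e0 _ e_orth _]] := cyclic_orthogonal_basis dot 0%VS n_gt0.
exists (fun i => normalize (e i)) => i j.
have [->|ij] := eqVneq i j; first by rewrite dot_normalize.
rewrite /normalize dotZl dotZr.
have lt_orth (a c : 'I_n) : (a < c)%N -> dot (e c) (e a) = 0.
  move=> ac; rewrite -(subnKC (ltnW ac)) e_orth //.
  by move: (ltn_ord c) ac; clear; lia.
have : dot (e i) (e j) = 0.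
  have /orP[/lt_orth/eqP|/lt_orth //] : (i < j)%N || (j < i)%N.
    by rewrite -neq_ltn.
  by rewrite dot_eq0C => /eqP.
by move=> ->; rewrite !mulr0.
Qed.

End OrthonormalFamily.

Section Wigner.
Variables (C : numClosedFieldType) (H : vectType C).
Variable dot : {dot H for Num.conj}.
Let n := \dim {:H}.
Variable h : H -> H.
Hypothesis n_gt2 : (2 < n)%N.
Hypothesis h_eq0 : forall v, (h v == 0) = (v == 0).
Hypothesis h_orth : forall v w, dot v w = 0 -> dot (h v) (h w) = 0.
Hypothesis h_inj : forall v w, v != 0 -> w != 0 ->
  h v \in <[h w]>%VS -> v \in <[w]>%VS.

Section Coordinates.
Variables (b e : 'I_n -> H) (o : 'I_n).
Hypothesis ob : orthonormal_family dot b.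
Hypothesis oe : orthonormal_family dot e.
Hypothesis e_in : forall i, e i \in <[h (b i)]>%VS.
Implicit Types (i j l : 'I_n) (v w : H).

Lemma family_neq0 i : b i != 0.
Proof. by rewrite -(dnorm_eq0 dot) ob eqxx oner_eq0. Qed.

Definition coef v i := dot (h v) (e i).

Lemma coef_expand v : h v = \sum_i coef v i *: e i.
Proof. exact: family_expand oe. Qed.

Lemma dot_expand v w :
  dot v w = \sum_i dot v (b i) * Num.conj (dot w (b i)).
Proof.
by rewrite [in LHS](family_expand v ob) [in LHS](family_expand w ob) dot_family2.
Qed.

Lemma coef_orth v w : dot v w = 0 ->
  \sum_i coef v i * Num.conj (coef w i) = 0.
Proof.
by move=> /h_orth; rewrite (coef_expand v) (coef_expand w) dot_family2.
Qed.

Lemma coef_eq0 v i : dot v (b i) = 0 -> coef v i = 0.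
Proof.
by move=> /h_orth vi; rewrite /coef; have /vlineP[c ->] := e_in i; rewrite dotZr vi mulr0.
Qed.

Definition ray2 j a := b o + a *: b j.
Definition ray3 j l a c := b o + a *: b j + c *: b l.

Lemma dot_ray2 v j a : dot v (ray2 j a) = dot v (b o) + Num.conj a * dot v (b j).
Proof. by rewrite dotDr dotZr. Qed.

Lemma dot_ray3 v j l a c : dot v (ray3 j l a c) =
  dot v (b o) + Num.conj a * dot v (b j) + Num.conj c * dot v (b l).
Proof. by rewrite !dotDr !dotZr. Qed.

Lemma ray2_coord j a i : dot (ray2 j a) (b i) = (o == i)%:R + a * (j == i)%:R.
Proof. by rewrite dotDl dotZl !ob. Qed.

Lemma ray3_coord j l a c i : dot (ray3 j l a c) (b i) =
  (o == i)%:R + a * (j == i)%:R + c * (l == i)%:R.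
Proof. by rewrite !dotDl !dotZl !ob. Qed.

Lemma neq0_coord v i : dot v (b i) != 0 -> v != 0.
Proof. by apply: contraNneq => ->; rewrite dot0l. Qed.

Lemma ray2_neq0 j a : j != o -> ray2 j a != 0.
Proof.
move=> jo; apply: (@neq0_coord _ o).
by rewrite ray2_coord eqxx (negbTE jo) mulr0 addr0 oner_eq0.
Qed.

Lemma coef_support v (P : pred 'I_n) :
  (forall i, ~~ P i -> dot v (b i) = 0) ->
  h v = \sum_(i | P i) coef v i *: e i.
Proof.
move=> vP; rewrite {1}coef_expand (bigID P) /= [X in _ + X]big1 ?addr0 // => i Pi.
by rewrite coef_eq0 ?vP // scale0r.
Qed.

Lemma h_in_line v i (c : C) : h v = c *: e i -> v != 0 -> v \in <[b i]>%VS.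
Proof.
move=> hv v0; apply: h_inj; rewrite ?family_neq0 //.
by rewrite hv memvZ.
Qed.

Lemma ray2_image j a : j != o ->
  h (ray2 j a) = coef (ray2 j a) o *: e o + coef (ray2 j a) j *: e j.
Proof.
move=> jo; rewrite (@coef_support _ (fun i => (i == o) || (i == j))) => [|i].
  rewrite (bigD1 o) ?eqxx //= (bigD1 j) /= ?eqxx ?orbT ?jo //.
  by rewrite big1 ?addr0 // => i; case: (i == o); case: (i == j).
rewrite negb_or ray2_coord eq_sym => /andP[/negbTE-> /negbTE ij].
by rewrite eq_sym ij mulr0 addr0.
Qed.

(** Otherwise injectivity on lines would put [ray2 j a] on the line of [b j], although its
    coordinate at [o] is 1. *)
Lemma coef_ray2_neq0 j a : j != o -> coef (ray2 j a) o != 0.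
Proof.
move=> jo; apply/eqP => c0; have := ray2_image a jo; rewrite c0 scale0r add0r.
move=> /h_in_line/(_ (ray2_neq0 a jo))/vlineP[c].
move=> /(congr1 (dot^~ (b o))); rewrite /= ray2_coord dotZl ob eqxx (negbTE jo).
by rewrite !mulr0 addr0 => /eqP; rewrite oner_eq0.
Qed.

(* The image under h of the line of b o + a *: b j is the line of
   e o + sigma j a *: e j. *)
Definition sigma j a := coef (ray2 j a) j / coef (ray2 j a) o.
(** The conjugations account for the second argument of [dot], where coordinates enter
    conjugated. *)
Definition tau j x := Num.conj (sigma j (Num.conj x)).

Lemma sigma0 j : j != o -> sigma j 0 = 0.
Proof.
move=> jo; rewrite /sigma coef_eq0 ?mul0r // ray2_coord.
by rewrite eq_sym (negbTE jo) mul0r addr0.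
Qed.

Lemma sigma_inj j : j != o -> injective (sigma j).
Proof.
move=> jo a a' eq_s.
have ca := coef_ray2_neq0 a jo; have ca' := coef_ray2_neq0 a' jo.
have : ray2 j a \in <[ray2 j a']>%VS.
  apply: h_inj; rewrite ?ray2_neq0 //; apply/vlineP.
  exists (coef (ray2 j a) o / coef (ray2 j a') o).
  rewrite (ray2_image a jo) (ray2_image a' jo) scalerDr.
  rewrite !scalerA divfK //.
  congr (_ + _ *: _); move/(canRL (divfK ca)): eq_s => ->.
  by rewrite /sigma mulrC mulrA [RHS]mulrAC.
case/vlineP => c E; have := congr1 (dot^~ (b o)) E; have := congr1 (dot^~ (b j)) E.
rewrite /= !dotZl !ray2_coord !eqxx [o == j]eq_sym (negbTE jo) !mulr0 !add0r !addr0.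
by rewrite !mulr1 => -> <-; rewrite mul1r.
Qed.

Lemma coef_orth_ray2 v j a : j != o ->
    dot v (b o) + Num.conj a * dot v (b j) = 0 ->
  coef v o + Num.conj (sigma j a) * coef v j = 0.
Proof.
move=> jo; rewrite -dot_ray2 => /h_orth; have c0 := coef_ray2_neq0 a jo.
rewrite (ray2_image a jo) dotDr !dotZr -!/(coef v _) => E.
apply: (@mulfI _ (Num.conj (coef (ray2 j a) o))); first by rewrite conjC_eq0.
rewrite mulr0 -[RHS]E mulrDr mulrA /sigma; congr (_ + _ * _).
by rewrite -rmorphM mulrC divfK.
Qed.

(** [ray2 j a] and [ray2 j (- (Num.conj a)^-1)] are orthogonal, hence so are their images. *)
Lemma sigma_inv j a : j != o -> a != 0 ->
  1 + Num.conj (sigma j (- (Num.conj a)^-1)) * sigma j a = 0.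
Proof.
move=> jo a0; have c0 := coef_ray2_neq0 a jo.
apply: (@mulfI _ (coef (ray2 j a) o)) => //.
have := @coef_orth_ray2 (ray2 j a) j (- (Num.conj a)^-1) jo.
rewrite !ray2_coord !eqxx [o == j]eq_sym (negbTE jo) !mulr0 add0r addr0 mulr1.
rewrite conjC_opp_inv mulNr mulVf // subrr => /(_ erefl) E.
rewrite -[RHS]E mulrDr mulr1 mulrCA; congr (_ + _ * _).
by rewrite /sigma mulrC divfK.
Qed.

(** With [a] the quotient of the coordinates, [v] and [ray2 j a] are both orthogonal to
    [ray2 j (- (Num.conj a)^-1)], which fixes the ratio of the two coefficients. *)
Lemma coef_sigma v j : j != o -> dot v (b o) != 0 ->
  coef v j = sigma j (dot v (b j) / dot v (b o)) * coef v o.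
Proof.
move=> jo vo; have [vj|vj] := eqVneq (dot v (b j)) 0.
  by rewrite coef_eq0 // vj mul0r sigma0 // mul0r.
set a := _ / _; have a0 : a != 0 by rewrite mulf_neq0 // invr_eq0.
have s0 := sigma_inv jo a0.
have := @coef_orth_ray2 v j (- (Num.conj a)^-1) jo.
rewrite conjC_opp_inv mulNr /a invf_div divfK // subrr => /(_ erefl).
rewrite -/a; move: s0; set t := Num.conj _ => s0 E.
have -> : coef v o = - (t * coef v j) by apply/eqP; rewrite -addr_eq0 E.
have /eqP := s0; rewrite addrC addr_eq0 => /eqP st.
by rewrite mulrN mulrA [_ * t]mulrC st mulN1r opprK.
Qed.

Lemma coef_o_neq0 v : dot v (b o) != 0 -> coef v o != 0.
Proof.
move=> vo; apply: contraNneq (neq0_coord vo) => co.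
rewrite -h_eq0 coef_expand big1 // => i _.
have [->|io] := eqVneq i o; first by rewrite co scale0r.
by rewrite coef_sigma // co mulr0 scale0r.
Qed.

(** The image of a [ray3] has coefficients only at [o], [j] and [l]; [coef_sigma] expresses them by
    the one at [o], which cancels. *)
Lemma coef_orth_ray3 v j l a c : j != o -> l != o -> l != j ->
    dot v (b o) + Num.conj a * dot v (b j) + Num.conj c * dot v (b l) = 0 ->
  coef v o + Num.conj (sigma j a) * coef v j + Num.conj (sigma l c) * coef v l = 0.
Proof.
move=> jo lo lj; rewrite -dot_ray3; set w := ray3 j l a c => vw.
have [wo wj wl] : [/\ dot w (b o) = 1, dot w (b j) = a & dot w (b l) = c].
  rewrite !ray3_coord !eqxx ![o == _]eq_sym [j == l]eq_sym.
  rewrite (negbTE jo) (negbTE lo) (negbTE lj).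
  by split; rewrite !(mulr0, addr0, mulr1, add0r).
have wo0 : dot w (b o) != 0 by rewrite wo oner_eq0.
have cw0 : Num.conj (coef w o) != 0 by rewrite conjC_eq0 coef_o_neq0.
apply: (mulfI cw0); rewrite mulr0 -[RHS](coef_orth vw).
rewrite (bigD1 o) //= (bigD1 j) //= (bigD1 l) /=; last by rewrite lo.
rewrite big1 ?addr0 => [|i /andP[/andP[/negbTE io /negbTE ij] /negbTE il]]; last first.
  rewrite [coef w i]coef_eq0 ?rmorph0 ?mulr0 // ray3_coord ![_ == i]eq_sym.
  by rewrite io ij il !mulr0 !addr0.
rewrite (coef_sigma jo wo0) (coef_sigma lo wo0) wo wj wl !divr1.
by rewrite (rmorphM _ (sigma j _)) (rmorphM _ (sigma l _)) /=; ring.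
Qed.

Lemma sigma_tau_orth j l a x c y : j != o -> l != o -> l != j ->
  1 + a * x + c * y = 0 ->
  1 + sigma j a * tau j x + sigma l c * tau l y = 0.
Proof.
move=> jo lo lj E; set v := ray3 j l a c.
have [vo vj vl] : [/\ dot v (b o) = 1, dot v (b j) = a & dot v (b l) = c].
  rewrite !ray3_coord !eqxx ![o == _]eq_sym [j == l]eq_sym.
  rewrite (negbTE jo) (negbTE lo) (negbTE lj).
  by split; rewrite !(mulr0, addr0, mulr1, add0r).
have vo0 : dot v (b o) != 0 by rewrite vo oner_eq0.
have := @coef_orth_ray3 v j l (Num.conj x) (Num.conj y) jo lo lj.
rewrite !conjCK vo vj vl (mulrC x) (mulrC y) => /(_ E).
rewrite (coef_sigma jo vo0) (coef_sigma lo vo0) vo vj vl !divr1 => E'.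
apply: (mulfI (coef_o_neq0 vo0)); rewrite mulr0 -[RHS]E' /tau; ring.
Qed.

Lemma sigma_odd j : j != o -> sigma j (-1) != sigma j 1.
Proof.
by move=> jo; apply/eqP => /(sigma_inj jo)/eqP; rewrite eqNr oner_eq0.
Qed.

(** The field endomorphism accompanying [h]; by [rhoE] it is the same for all [j] other than [o]. *)
Definition rho j := coord_prod (sigma j) (tau j).

Lemma third_index j : exists l, (l != o) && (l != j).
Proof.
have : (0 < #|~: [set o; j]|)%N.
  have := cardsC [set o; j]; rewrite card_ord cards2.
  by move: n_gt2; clear; case: (_ != _) => /=; lia.
by case/card_gt0P => l; rewrite !inE negb_or; exists l.
Qed.

Lemma rhoE j l a : j != o -> l != o -> rho j a = rho l a.
Proof.
move=> jo lo; have [->//|jl] := eqVneq j l.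
apply: (coord_prod_eq (sigma0 jo) (sigma0 lo) (sigma_odd jo) (sigma_odd lo)).
by move=> a' x c y; apply: sigma_tau_orth; rewrite // eq_sym.
Qed.

Lemma rho_morph j : j != o -> [/\ rho j 1 = 1,
  {morph rho j : a c / a * c} & {morph rho j : a c / a + c}].
Proof.
move=> jo; have [l /andP[lo lj]] := third_index j.
have st := fun a x c y => @sigma_tau_orth j l a x c y jo lo lj.
split; first exact: coord_prod_1 (sigma0 lo) (sigma_odd jo) st.
  exact: coord_prodM (sigma0 lo) (sigma_odd jo) st.
exact: coord_prodD (sigma0 jo) (sigma0 lo) (sigma_odd jo) (sigma_odd lo) st.
Qed.

Lemma sigma_rho j a : j != o -> sigma j a = rho j a * sigma j 1.
Proof.
move=> jo; have [rho1 _ _] := rho_morph jo.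
rewrite /rho /coord_prod -mulrA [tau j 1 * _]mulrC -/(coord_prod _ _ _).
by rewrite -/(rho j 1) rho1 mulr1.
Qed.

Lemma tau_rho j x : j != o -> tau j x = rho j x * tau j 1.
Proof.
move=> jo; have [l /andP[lo lj]] := third_index j.
have [rho1 _ _] := rho_morph jo.
have st := fun a x c y => @sigma_tau_orth j l a x c y jo lo lj.
rewrite /rho -[x in RHS]mul1r -(coord_prodE st) mulrAC.
by rewrite -/(coord_prod _ _ _) -/(rho j 1) rho1 mul1r.
Qed.

Lemma rho_conj j a : j != o -> rho j (Num.conj a) = Num.conj (rho j a).
Proof.
move=> jo; have [rho1 _ _] := rho_morph jo.
have conj_tau1 : Num.conj (tau j 1) = sigma j 1 by rewrite /tau conjCK rmorph1.
have conj_sigma : Num.conj (sigma j a) = tau j (Num.conj a) by rewrite /tau conjCK.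
rewrite {2}/rho /coord_prod rmorphM /= conj_tau1 conj_sigma tau_rho //.
by rewrite -mulrA [tau j 1 * _]mulrC -/(coord_prod _ _ _) -/(rho j 1) rho1 mulr1.
Qed.

(** The constant factor of [sigma i] beside [rho]; having modulus 1, it can be absorbed into the
    basis [e]. *)
Definition phase i := if i == o then 1 else sigma i 1.

Lemma phase_unitary i : phase i * Num.conj (phase i) = 1.
Proof.
rewrite /phase; have [_|io] := eqVneq i o; first by rewrite rmorph1 mulr1.
by have [r1 _ _] := rho_morph io; rewrite -[RHS]r1 /rho /coord_prod /tau rmorph1.
Qed.

Lemma phase_neq0 i : phase i != 0.
Proof.
apply: contraTneq (oner_neq0 C) => p0.
by rewrite -(phase_unitary i) p0 mul0r eqxx.
Qed.

Lemma phased_orthonormal : orthonormal_family dot (fun i => phase i *: e i).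
Proof.
move=> i j; rewrite dotZl dotZr oe; have [->|_] := eqVneq i j; last by rewrite !mulr0.
by rewrite mulr1 phase_unitary.
Qed.

Lemma rho0 j : j != o -> rho j 0 = 0.
Proof. by move=> jo; rewrite /rho /coord_prod sigma0 // mul0r. Qed.

Lemma rho_neq0 j a : j != o -> a != 0 -> rho j a != 0.
Proof.
move=> jo a0; have [rho1 rhoM _] := rho_morph jo.
apply: contraTneq (oner_neq0 C) => r0.
by rewrite -rho1 -(mulfV a0) rhoM r0 mul0r eqxx.
Qed.

Lemma coef_rho p v : p != o -> v != 0 ->
  exists d, forall i, coef v i = d * (rho p (dot v (b i)) * phase i).
Proof.
move=> po v0; have [rho1 rhoM rhoD] := rho_morph po.
have [vo|vo] := eqVneq (dot v (b o)) 0; last first.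
  exists (coef v o / rho p (dot v (b o))) => i.
  rewrite /phase; have [->|io] := eqVneq i o.
    by rewrite mulr1 divfK ?rho_neq0.
  rewrite coef_sigma // sigma_rho // (rhoE _ io po).
  have -> : rho p (dot v (b i)) =
      rho p (dot v (b i) / dot v (b o)) * rho p (dot v (b o)) by rewrite -rhoM divfK.
  by field; rewrite rho_neq0.
have [j vj] : exists j, dot v (b j) != 0.
  apply/existsP; rewrite -negb_forall; apply: contra v0 => /forallP v_eq0.
  by rewrite (family_expand v ob) big1 // => i _; rewrite (eqP (v_eq0 i)) scale0r.
have jo : j != o by apply: contraNneq vj => ->; rewrite vo.
exists (coef v j / (rho p (dot v (b j)) * phase j)) => i.
have [->|ij] := eqVneq i j.
  by rewrite divfK // mulf_neq0 ?rho_neq0 ?phase_neq0.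
have [->|io] := eqVneq i o; first by rewrite vo rho0 // mul0r mulr0 coef_eq0.
(* This [ray3] is orthogonal to [v]: it carries the coordinates of [v] at [i] and [j] exchanged,
   conjugated and one negated. It links the coefficients at [i] and [j]. *)
have := @coef_orth_ray3 v j i
  (Num.conj (- dot v (b i))) (Num.conj (dot v (b j))) jo io ij.
rewrite !conjCK vo coef_eq0 // !add0r mulrC mulrN addNr => /(_ erefl).
rewrite -!/(tau _ _) (tau_rho _ jo) (tau_rho _ io) !(rhoE _ jo po) !(rhoE _ io po).
rewrite /phase (negbTE jo) (negbTE io).
have -> : rho p (- dot v (b i)) = - rho p (dot v (b i)).
  by apply/eqP; rewrite -addr_eq0 -rhoD addNr rho0.
have tauE l : l != o -> tau l 1 = (sigma l 1)^-1.
  move=> lo; have [r1 _ _] := rho_morph lo.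
  apply: (@mulfI _ (sigma l 1)); rewrite -?[sigma l 1 * tau l 1]/(rho l 1).
    by have := phase_neq0 l; rewrite /phase (negbTE lo).
  by rewrite r1 mulfV //; have := phase_neq0 l; rewrite /phase (negbTE lo).
rewrite !tauE // => E.
have sj : sigma j 1 != 0 by have := phase_neq0 j; rewrite /phase (negbTE jo).
have si : sigma i 1 != 0 by have := phase_neq0 i; rewrite /phase (negbTE io).
have rj : rho p (dot v (b j)) != 0 by rewrite rho_neq0.
apply: (mulfI (mulf_neq0 rj (invr_neq0 si))); apply/eqP; rewrite -subr_eq0.
by rewrite -[X in _ == X]E; apply/eqP; field; rewrite sj si rj.
Qed.

Lemma line_map_coordinates p v : p != o -> v != 0 ->
  h v \in <[\sum_i rho p (dot v (b i)) *: (phase i *: e i)]>%VS.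
Proof.
move=> po v0; have [d dP] := coef_rho po v0; apply/vlineP; exists d.
rewrite {1}coef_expand scaler_sumr; apply: eq_bigr => i _.
by rewrite dP !scalerA mulrA.
Qed.

End Coordinates.

Lemma wigner : exists (b c : 'I_n -> H) (r : C -> C),
  [/\ orthonormal_family dot b, orthonormal_family dot c,
      [/\ r 1 = 1, {morph r : x y / x * y}, {morph r : x y / x + y}
        & forall x, r (Num.conj x) = Num.conj (r x)]
    & forall v, v != 0 -> h v \in <[\sum_i r (dot v (b i)) *: c i]>%VS].
Proof.
have [b ob] := orthonormal_family_exists dot.
have n_gt0 : (0 < n)%N by move: n_gt2; clear; lia.
have n_gt1 : (1 < n)%N by move: n_gt2; clear; lia.
pose o := Ordinal n_gt0; pose p := Ordinal n_gt1.
have po : p != o by [].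
pose e i := normalize dot (h (b i)).
have b0 i : h (b i) != 0 by rewrite h_eq0 -(dnorm_eq0 dot) ob eqxx oner_eq0.
have oe : orthonormal_family dot e.
  move=> i j; have [->|ij] := eqVneq i j; first by rewrite dot_normalize.
  have hij : dot (h (b i)) (h (b j)) = 0 by apply: h_orth; rewrite ob (negbTE ij).
  by rewrite /e /normalize dotZl dotZr hij !mulr0.
have e_in i : e i \in <[h (b i)]>%VS by rewrite memvZ // memv_line.
have [rho1 rhoM rhoD] := rho_morph ob oe e_in po.
exists b, (fun i => phase b e o i *: e i), (rho b e o p); split=> //.
- exact: phased_orthonormal.
- by split=> // x; exact: rho_conj.
- by move=> v v0; exact: line_map_coordinates.
Qed.
End Wigner.

(** * Linear and conjugate-linear extensions *)

Section ComplexEndomorphism.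
Variables (R : realType) (r : {rmorphism R[i] -> R[i]}).
Hypothesis r_conj : forall x, r (Num.conj x) = Num.conj (r x).

Lemma endo_ge0 x : 0 <= x -> 0 <= r x.
Proof.
move=> x0; have -> : x = sqrtC x * Num.conj (sqrtC x).
  by rewrite geC0_conj ?sqrtC_ge0 // -expr2 sqrtCK.
by rewrite rmorphM r_conj mul_conjC_ge0.
Qed.

(** [r] preserves nonnegativity, hence the order, and fixes the rationals, so no rational separates
    [x] from [r x]. *)
Lemma endo_real x : x \is Num.real -> r x = x.
Proof.
move=> xR; have rxR : r x \is Num.real by apply/CrealP; rewrite -r_conj (CrealP xR).
have /complex_realP[a xE] := xR; have /complex_realP[b rxE] := rxR.
have bound c d q : r (real_complex R c) = real_complex R d -> (ratr q <= c) = true ->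
    ratr q <= d.
  move=> E le_qc; rewrite -lecR -E.
  have ratE : real_complex R (ratr q) = ratr q by rewrite fmorph_rat.
  rewrite ratE -(fmorph_rat r) -subr_ge0 -rmorphB endo_ge0 // subr_ge0 -ratE.
  by rewrite lecR.
have rab : r (real_complex R a) = real_complex R b by rewrite -xE.
(* [bound] transfers rational lower bounds only; upper ones come from [- a]. *)
have rabN : r (real_complex R (- a)) = real_complex R (- b).
  by rewrite !rmorphN /= rab.
rewrite rxE xE; congr (real_complex R _); apply/eqP; rewrite eq_le.
apply/andP; split; rewrite leNgt; apply/negP => /rat_in_itvoo[q].
  rewrite in_itv /= => /andP[aq qb]; have := bound _ _ (- q) rabN.
  by rewrite rmorphN lerN2 (ltW aq) lerN2 leNgt qb => /(_ erefl).
rewrite in_itv /= => /andP[bq qa]; have := bound _ _ q rab.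
by rewrite (ltW qa) leNgt bq => /(_ erefl).
Qed.

(** [r] fixes the reals and sends ['i] to a square root of [-1]. *)
Lemma endo_id_or_conj : r =1 id \/ r =1 Num.conj.
Proof.
have : (r 'i - 'i) * (r 'i + 'i) = 0.
  by rewrite -subr_sqr -rmorphXn /= sqrCi rmorphN rmorph1 subrr.
have rE x : r x = 'Re x + r 'i * 'Im x.
  rewrite {1}[x]Crect rmorphD rmorphM /=.
  by rewrite (endo_real (Creal_Re x)) (endo_real (Creal_Im x)).
move/eqP; rewrite mulf_eq0 subr_eq0 addr_eq0 => /orP[]/eqP ri; [left|right] => x.
  by rewrite rE ri -Crect.
by rewrite rE ri [x in RHS]Crect conjC_rect ?Creal_Re ?Creal_Im ?mulNr.
Qed.

End ComplexEndomorphism.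

Section SemilinearIsometry.
Variables (C : numClosedFieldType) (H : vectType C).
Variable dot : {dot H for Num.conj}.
Let n := \dim {:H}.
Variable r : {rmorphism C -> C}.
Hypothesis rK : involutive r.
Hypothesis r_conj : forall x, r (Num.conj x) = Num.conj (r x).

Definition semilinear_frame_map (b c : 'I_n -> H) v :=
  \sum_i r (dot v (b i)) *: c i.

Variables b c : 'I_n -> H.
Hypothesis ob : orthonormal_family dot b.
Hypothesis oc : orthonormal_family dot c.
Let U := semilinear_frame_map b c.

Lemma semilinear_frame_mapP a v w : U (a *: v + w) = r a *: U v + U w.
Proof.
rewrite /U /semilinear_frame_map scaler_sumr -big_split /=.
apply: eq_bigr => i _; rewrite dotDl dotZl rmorphD rmorphM /=.
by rewrite scalerDl scalerA.
Qed.

Lemma semilinear_frame_map0 : U 0 = 0.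
Proof.
have := semilinear_frame_mapP 1 0 0; rewrite scale1r addr0 rmorph1 scale1r.
by move/eqP; rewrite -subr_eq subrr eq_sym => /eqP.
Qed.

Lemma semilinear_frame_map_sum (I : Type) (s : seq I) (a : I -> C) (E : I -> H) :
  U (\sum_(i <- s) a i *: E i) = \sum_(i <- s) r (a i) *: U (E i).
Proof.
elim: s => [|i s IHs]; first by rewrite !big_nil semilinear_frame_map0.
by rewrite !big_cons semilinear_frame_mapP IHs.
Qed.

Lemma semilinear_frame_mapK : cancel U (semilinear_frame_map c b).
Proof.
move=> v; rewrite [RHS](family_expand v ob); apply: eq_bigr => i _.
by rewrite dot_family // rK.
Qed.

Lemma dot_semilinear_frame_map v w : dot (U v) (U w) = r (dot v w).
Proof.
rewrite dot_family2 // (dot_expand ob v w) rmorph_sum /=; apply: eq_bigr => i _.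
by rewrite rmorphM /= r_conj.
Qed.

Lemma semilinear_frame_map_eq0 v : (U v == 0) = (v == 0).
Proof.
by rewrite -!(dnorm_eq0 dot) dot_semilinear_frame_map fmorph_eq0.
Qed.

Lemma semilinear_frame_map_orth v w : dot v w = 0 -> dot (U v) (U w) = 0.
Proof. by move=> vw; rewrite dot_semilinear_frame_map vw rmorph0. Qed.

End SemilinearIsometry.

(** * The transformation of the Grassmannian *)

Section GrassmannTransformation.
Variables (R : realType) (H : vectType R[i]).
Variable dot : {dot H for Num.conj}.
Variables (k : nat) (f : grassmannian H k -> grassmannian H k).
Hypothesis k_gt0 : (0 < k)%N.
Hypothesis n_gt2k : (2 * k < \dim {:H})%N.
Hypothesis f_inj : injective f.
Hypothesis f_orth : forall X Y : grassmannian H k,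
  orthogonal_subspaces dot (val X) (val Y) ->
  orthogonal_subspaces dot (val (f X)) (val (f Y)).

(** The value 0 outside dimension [k] is a mere default. *)
Definition extend_to_vspaces (X : {vspace H}) : {vspace H} :=
  if insub X is Some Z then val (f Z) else 0%VS.

Let F := extend_to_vspaces.

Lemma extend_val (X : grassmannian H k) : F (val X) = val (f X).
Proof. by rewrite /F /extend_to_vspaces valK. Qed.

Lemma grassmannianP (X : {vspace H}) : \dim X = k ->
  exists Z : grassmannian H k, val Z = X.
Proof. by move/eqP => dX; exists (exist _ X dX). Qed.

Lemma dim_grassmannian (X : grassmannian H k) : \dim (val X) = k.
Proof. exact/eqP/(valP X). Qed.

Lemma dim_extend X : \dim X = k -> \dim (F X) = k.
Proof. by case/grassmannianP => Z <-; rewrite extend_val dim_grassmannian. Qed.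

Lemma extend_inj X Y : \dim X = k -> \dim Y = k -> F X = F Y -> X = Y.
Proof.
case/grassmannianP => Z <-; case/grassmannianP => Z' <-.
by rewrite !extend_val => /val_inj/f_inj->.
Qed.

Lemma extend_orth X Y : \dim X = k -> \dim Y = k ->
  (X <= orthov dot Y)%VS -> (F X <= orthov dot (F Y))%VS.
Proof.
case/grassmannianP => Z <-; case/grassmannianP => Z' <-.
by rewrite !extend_val => /orthovP ?; apply/orthovP; exact: f_orth.
Qed.

Lemma grassmann_transformation : bijective f /\
  exists U : H -> H, (unitary dot U \/ antiunitary dot U) /\
    forall X : grassmannian H k, is_image U (val X) (val (f X)).
Proof.
have [h [h0 hF h_orth]] :=
  line_map_exists k_gt0 n_gt2k dim_extend extend_inj extend_orth.
have h_inj := line_map_inj n_gt2k k_gt0 dim_extend extend_inj h0 hF h_orth.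
have n_gt2 : (2 < \dim {:H})%N by move: k_gt0 n_gt2k; clear; lia.
have [b [c [rho [ob oc [rho1 rhoM rhoD rho_conj] hU]]]] := wigner n_gt2 h0 h_orth h_inj.
have rho0 : rho 0 = 0.
  by have /eqP := rhoD 0 0; rewrite addr0 -subr_eq subrr eq_sym => /eqP.
have rhoB : {morph rho : x y / x - y}.
  move=> x y; rewrite rhoD; congr (_ + _).
  by apply/eqP; rewrite -addr_eq0 -rhoD addNr rho0.
pose rhoA := GRing.isZmodMorphism.Build _ _ rho rhoB.
pose rhoMM := GRing.isMonoidMorphism.Build _ _ rho (conj rho1 rhoM).
pose r : {rmorphism R[i] -> R[i]} := HB.pack rho rhoA rhoMM.
have r_conj x : r (Num.conj x) = Num.conj (r x) by exact: rho_conj.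
have r_cases := endo_id_or_conj r_conj.
have rK : involutive r.
  by case: r_cases => rE x; rewrite !rE ?conjCK.
pose U := semilinear_frame_map dot r b c; pose V := semilinear_frame_map dot r c b.
have UP a v w : U (a *: v + w) = r a *: U v + U w.
  exact: semilinear_frame_mapP.
have U_dot v w : dot (U v) (U w) = r (dot v w).
  exact: dot_semilinear_frame_map.
have UK : cancel U V := semilinear_frame_mapK rK ob oc.
have VK : cancel V U := semilinear_frame_mapK rK oc ob.
have U0 v : (U v == 0) = (v == 0) := semilinear_frame_map_eq0 r_conj ob oc v.
have V0 v : (V v == 0) = (v == 0) := semilinear_frame_map_eq0 r_conj oc ob v.
have U_orth v w : dot v w = 0 -> dot (U v) (U w) = 0.
  exact: semilinear_frame_map_orth.
have V_orth v w : dot v w = 0 -> dot (V v) (V w) = 0.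
  exact: semilinear_frame_map_orth.
(* [U v] spans the line of [h v], so membership in [F X] passes from [h] to [U]. *)
have UF v X : \dim X = k -> v \in X -> U v \in F X.
  move=> dimX vX; have [->|v0] := eqVneq v 0.
    by rewrite (eqP (_ : U 0 == 0)) ?mem0v // U0.
  have /vlineP[d hv] := hU v v0.
  have d0 : d != 0.
    by apply: contraNneq v0 => d0; rewrite -h0 hv d0 scale0r.
  have -> : U v = d^-1 *: h v by rewrite hv scalerA mulVf // scale1r.
  by rewrite memvZ // hF.
have F_span := image_of_span dim_extend U0 UF U_orth.
split.
  (* The preimage of [Y] is spanned by the vectors that [V] assigns to an orthogonal basis of
     [Y]. *)
  have f_surj Y : exists X, f X = Y.
    have [s os span_s] := orthogonal_basis dot (val Y).
    have size_s : size s = k.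
      by rewrite -(dim_grassmannian Y) -span_s; apply/esym/eqP; exact: orthogonal_free os.
    have osV := pairwise_orthogonal_map V0 V_orth os.
    have size_V : size (map V s) = k by rewrite size_map.
    have dimV : \dim <<map V s>> = k by rewrite (eqP (orthogonal_free osV)).
    have [X XE] := grassmannianP dimV.
    exists X; apply: val_inj; rewrite -extend_val XE [LHS]F_span //.
    by rewrite -map_comp (eq_map VK) map_id.
  have [g gK] := choice f_surj.
  by exists g => // X; apply: f_inj; rewrite gK.
exists U; split.
  case: r_cases => rE; [left|right]; split.
  - by move=> a v w; rewrite UP rE.
  - by exists V.
  - by move=> v w; rewrite U_dot rE.
  - by move=> a v w; rewrite UP rE.
  - by exists V.
  - by move=> v w; rewrite U_dot rE.
move=> X y; rewrite -extend_val; have dimX := dim_grassmannian X.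
split=> [yF|[x xX ->]]; last exact: UF.
have [s os span_s] := orthogonal_basis dot (val X).
have size_s : size s = k.
  by rewrite -dimX -span_s; apply/esym/eqP; exact: orthogonal_free os.
exists (V y); last by rewrite VK.
(* As [F <<s>>] is spanned by [map U s], the semilinear inverse [V] takes [y] back into [<<s>>]. *)
move: yF; rewrite -span_s F_span // => /(@coord_span _ _ _ (in_tuple _)) ->.
rewrite [V _]semilinear_frame_map_sum; apply: memv_suml => i _.
rewrite memvZ // memv_span //=; have lt_i : (i < size s)%N.
  by have := ltn_ord i; rewrite [X in (_ < X)%N]size_map.
by rewrite (nth_map 0) // -/V UK mem_nth.
Qed.

End GrassmannTransformation.

Theorem theorem1 (R : realType) (H : vectType R[i])
    (dot : {dot H for Num.conj}) (k m i : nat)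
    (k_gt0 : (0 < k)%N)
    (dimH_gt : (2 * k < \dim {:H})%N)
    (dimH : \dim {:H} = (m * k + i)%N)
    (m_ge2 : (2 <= m)%N)
    (i_ltk : (i < k)%N)
    (cond : (i <= 3)%N \/ ((4 <= i)%N /\ (i + 1 <= m)%N))
    (f : grassmannian H k -> grassmannian H k)
    (f_inj : injective f)
    (f_orth : forall X Y : grassmannian H k,
      orthogonal_subspaces dot (val X) (val Y) ->
      orthogonal_subspaces dot (val (f X)) (val (f Y))) :
  bijective f /\
  exists U : H -> H,
    (unitary dot U \/ antiunitary dot U) /\
    forall X : grassmannian H k, is_image U (val X) (val (f X)).
Proof. exact: grassmann_transformation. Qed.
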